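(* Let $\theta<\lambda$ be infinite cardinals. If $J[\lambda^+]$ contains a stationary subset of $E^{\lambda^+}_\theta$, then $J[\lambda^+]$ contains every stationary subset of $E^{\lambda^+}_\theta$ that lies in $I[\lambda^+]$. In particular, if $\lambda$ is regular and $J[\lambda^+]$ contains a stationary subset of $E^{\lambda^+}_\theta$, then $E^{\lambda^+}_\theta\in J[\lambda^+]$.
   Context: For a regular uncountable cardinal $\kappa$, $E^\kappa_\theta=\{\alpha<\kappa\mid\mathrm{cf}(\alpha)=\theta\}$, and $[\kappa]^{<\chi}$ is the set of subsets of $\kappa$ of size $<\chi$. For $\chi$ either $2$ or an infinite cardinal, $J_\chi[\kappa]$ is the collection of all $S\subseteq\kappa$ for which there exist a club $C\subseteq\kappa$ and functions $f_i:\kappa\to[\kappa]^{<\chi}$ ($i<\kappa$) such that for every $\alpha\in S\cap C$, every regressive $f:\alpha\to\alpha$ and every cofinal $B\subseteq\alpha$, there is $i<\alpha$ with $\sup\{\beta\in B\mid f(\beta)\in f_i(\beta)\}=\alpha$. $J[\kappa]$ denotes $J_2[\kappa]$ (so each $f_i(\beta)$ is empty or a singleton). $I[\kappa]$ is Shelah's approachability ideal: $S\in I[\kappa]$ iff there are a sequence $\langle a_\beta\mid\beta<\kappa\rangle$ of bounded subsets of $\kappa$ and a club $C\subseteq\kappa$ such that each $\alpha\in S\cap C$ has a cofinal $A\subseteq\alpha$ of order type $\mathrm{cf}(\alpha)$ with $\{A\cap\gamma\mid\gamma<\alpha\}\subseteq\{a_\beta\mid\beta<\alpha\}$. *)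

(* Defs.v *)
(* Ordinals below lambda^+ are modelled as the elements of an
   abstract well-ordered type K whose order type is lambda^+ (see [successor_of]). *)
From Stdlib Require Import Classical.

Record wo := WO {
  car :> Type;
  lt : car -> car -> Prop;
  lt_irrefl : forall x, ~ lt x x;
  lt_trans : forall x y z, lt x y -> lt y z -> lt x z;
  lt_total : forall x y, lt x y \/ x = y \/ lt y x;
  lt_wf : well_founded lt }.

Arguments lt {w} _ _.

Section Defs.
Variable K : wo.

Definition le (x y : K) : Prop := lt x y \/ x = y.

Definition seg (a : K) : Type := { x : K | lt x a }.

Definition card_le (a b : K) : Prop :=
  exists f : seg a -> seg b, forall x y, f x = f y -> x = y.

Definition is_cardinal (a : K) : Prop := forall b, lt b a -> ~ card_le a b.

Definition is_infinite (a : K) : Prop :=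
  exists f : nat -> seg a, forall m n, f m = f n -> m = n.

Definition inf_cardinal (a : K) : Prop := is_cardinal a /\ is_infinite a.

(* K has order type lam^+ : every proper initial segment has size <= lam,
   while K itself has size > lam *)
Definition successor_of (lam : K) : Prop :=
  inf_cardinal lam /\ (forall a, card_le a lam) /\
  ~ (exists f : K -> seg lam, forall x y, f x = f y -> x = y).

Definition cofinal_in (A : K -> Prop) (a : K) : Prop :=
  (forall x, A x -> lt x a) /\ (forall b, lt b a -> exists x, A x /\ le b x).

Definition ordertype_is (A : K -> Prop) (t : K) : Prop :=
  exists g : seg t -> K,
    (forall x y, lt (proj1_sig x) (proj1_sig y) -> lt (g x) (g y)) /\
    (forall z, A z <-> exists x, g x = z).

Definition cof (a t : K) : Prop :=
  (exists A, cofinal_in A a /\ ordertype_is A t) /\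
  (forall s, lt s t -> ~ exists A, cofinal_in A a /\ ordertype_is A s).

Definition regular (a : K) : Prop := cof a a.

Definition E (t : K) : K -> Prop := fun a => cof a t.

Definition subset (S T : K -> Prop) : Prop := forall x, S x -> T x.

Definition club (C : K -> Prop) : Prop :=
  (forall b, exists x, C x /\ lt b x) /\
  (forall a, (exists b, lt b a) ->
     (forall b, lt b a -> exists x, C x /\ lt b x /\ lt x a) -> C a).

Definition stationary (S : K -> Prop) : Prop :=
  forall C, club C -> exists a, S a /\ C a.

Definition sup_is (X : K -> Prop) (a : K) : Prop :=
  (forall x, X x -> lt x a) /\ (forall b, lt b a -> exists x, X x /\ lt b x).

Definition regressive_on (f : K -> K) (a : K) : Prop :=
  forall b, lt b a -> lt (f b) a /\ ((exists c, lt c b) -> lt (f b) b).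

Definition small2 (X : K -> Prop) : Prop := forall x y, X x -> X y -> x = y.

Definition inJ (S : K -> Prop) : Prop :=
  exists C, club C /\
  exists fs : K -> K -> (K -> Prop),
    (forall i b, small2 (fs i b)) /\
    forall a, S a -> C a ->
      forall f : K -> K, regressive_on f a ->
      forall B : K -> Prop, sup_is B a ->
        exists i, lt i a /\ sup_is (fun b => B b /\ fs i b (f b)) a.

Definition bounded (X : K -> Prop) : Prop := exists d, forall x, X x -> lt x d.

Definition inI (S : K -> Prop) : Prop :=
  exists a_ : K -> (K -> Prop), (forall b, bounded (a_ b)) /\
  exists C, club C /\
    forall a, S a -> C a ->
      exists A, cofinal_in A a /\ (exists t, cof a t /\ ordertype_is A t) /\
        forall g, lt g a -> exists b, lt b a /\
          forall x, a_ b x <-> (A x /\ lt x g).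

End Defs.

(* Main.v *)
(* Fix one point [astar > lam] of [T] at which the guessing functions work. Since [astar] has
   size [lam], they form [lam] many functions, and transported along cofinal maps they serve
   every point [a] of cofinality [theta]; only the position of [b] on the way to [a] remains to
   be computed from [b] alone. Diagonalizing against these [lam] many functions shows moreover
   that [theta] and [lam] have different cofinalities, so every function from a cofinal subset
   of [a] to [lam] is bounded on a cofinal subset.

   The position is read off functions [Y : K -> lam] built greedily. With injections
   [e b : b -> lam], and sets [W i b] of size [< lam], let [Y b] differ from all [Y b'] such that
   [e c b' < i'] for some [c] in [W i b] above [b']. For [a] in an approachable set, [W i b] is
   the union of the [theta]-sized sets enumerated at indices [d < b] with [e b d < i]; it contains
   the initial segments of the cofinal set [A] of [a], so for suitable [i], [i'] the function [Y]
   takes each value boundedly often on a cofinal set. For regular [lam] one may take [W i b = {b}]: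
   a set of size [theta] has all its values [e b b'] bounded below [lam]. *)
From Stdlib Require Import Classical ClassicalEpsilon FunctionalExtensionality Wellfounded
  Relation_Operators Lexicographic_Product Cantor.
Require Import Defs.

Local Notation "x << y" := (lt x y) (at level 70).
Local Notation "x <<= y" := (le _ x y) (at level 70).

(** * Recursion along well-founded relations with a choice at each stage *)

Definition inj_on {X Y : Type} (P : X -> Prop) (f : X -> Y) : Prop :=
  forall x y, P x -> P y -> f x = f y -> x = y.

(** As [Q x] depends only on values at [R]-predecessors, the partial function known at stage [x] can
    be padded by [y0] before the next value is chosen. *)
Lemma wf_choice (X Y : Type) (y0 : Y) (R : X -> X -> Prop) (Q : X -> (X -> Y) -> Y -> Prop) :
  well_founded R ->
  (forall x f f' v, (forall y, R y x -> f y = f' y) -> Q x f v -> Q x f' v) ->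
  (forall x f, exists v, Q x f v) ->
  exists F, forall x, Q x F (F x).
Proof.
  intros Rwf Qext Qex.
  pose (ext := fun x (rec : forall y, R y x -> Y) y =>
    match excluded_middle_informative (R y x) with
    | left h => rec y h | right _ => y0 end).
  pose (step := fun x rec => epsilon (inhabits y0) (Q x (ext x rec))).
  exists (Fix Rwf (fun _ => Y) step). intro x.
  rewrite Fix_eq.
  - unfold step at 2. eapply Qext; [|apply epsilon_spec, Qex].
    intros y Ryx. unfold ext.
    now destruct (excluded_middle_informative (R y x)).
  - intros z f g fg. replace g with f; [reflexivity|].
    extensionality y; extensionality h; apply fg.
Qed.

(** Serves where predecessors are too few to exhaust [V]: for injections of well-ordered sets and
    for the functions [Y]. *)
Lemma greedy (X Y : Type) (y0 : Y) (V : Y -> Prop) (R : X -> X -> Prop) :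
  well_founded R ->
  (forall x (f : X -> Y), exists v, V v /\ forall y, R y x -> f y <> v) ->
  exists F : X -> Y, forall x, V (F x) /\ forall y, R y x -> F y <> F x.
Proof.
  intros Rwf H.
  apply (wf_choice X Y y0 R (fun x f v => V v /\ forall y, R y x -> f y <> v) Rwf); [|exact H].
  intros x f f' v e [Vv fv]; split; [exact Vv|].
  intros y Ryx; rewrite <- e by assumption; now apply fv.
Qed.

(** * Order reasoning in well-orders *)

Section WellOrders.
Context {K : wo}.

Lemma wo_le_or_lt (x y : K) : x <<= y \/ y << x.
Proof. unfold le; destruct (lt_total K x y) as [?|[?|?]]; auto. Qed.

Lemma wo_not_lt (x y : K) : ~ x << y -> y <<= x.
Proof. destruct (wo_le_or_lt y x); tauto. Qed.

Lemma wo_not_le (x y : K) : ~ x <<= y -> y << x.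
Proof. destruct (wo_le_or_lt x y); tauto. Qed.

Lemma wo_le_refl (x : K) : x <<= x.
Proof. now right. Qed.

Lemma wo_le_trans (x y z : K) : x <<= y -> y <<= z -> x <<= z.
Proof. intros [a| ->] [b| ->]; unfold le; eauto using lt_trans. Qed.

Lemma wo_lt_le_trans (x y z : K) : x << y -> y <<= z -> x << z.
Proof. intros a [b| ->]; eauto using lt_trans. Qed.

Lemma wo_le_lt_trans (x y z : K) : x <<= y -> y << z -> x << z.
Proof. intros [a| ->] b; eauto using lt_trans. Qed.

Lemma wo_least (P : K -> Prop) : (exists x, P x) ->
  exists x, P x /\ forall y, P y -> x <<= y.
Proof.
  intros [x0 Px0]. revert Px0.
  induction x0 as [x IH] using (well_founded_ind (lt_wf K)). intro Px.
  destruct (classic (exists y, P y /\ y << x)) as [[y [Py yx]]|no].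
  - now apply (IH y).
  - exists x; split; [exact Px|]. intros y Py. apply wo_not_lt. eauto.
Qed.

Lemma wo_max (x y : K) : exists z, (z = x \/ z = y) /\ x <<= z /\ y <<= z.
Proof.
  destruct (wo_le_or_lt x y).
  - exists y; auto using wo_le_refl.
  - exists x; unfold le; auto.
Qed.

End WellOrders.

Ltac wo_saturate :=
  repeat match goal with
  | H : lt ?x ?x |- _ => exfalso; exact (lt_irrefl _ _ H)
  | H : lt ?x ?y, H' : lt ?y ?z |- _ =>
      lazymatch goal with _ : lt x z |- _ => fail | _ => pose proof (lt_trans _ _ _ _ H H') end
  | H : lt ?x ?y, H' : le _ ?y ?z |- _ =>
      lazymatch goal with _ : lt x z |- _ => fail | _ => pose proof (wo_lt_le_trans _ _ _ H H') end
  | H : le _ ?x ?y, H' : lt ?y ?z |- _ =>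
      lazymatch goal with _ : lt x z |- _ => fail | _ => pose proof (wo_le_lt_trans _ _ _ H H') end
  | H : le _ ?x ?y, H' : le _ ?y ?z |- _ =>
      lazymatch goal with _ : le _ x z |- _ => fail | _ => pose proof (wo_le_trans _ _ _ H H') end
  end.

Ltac order :=
  try lazymatch goal with
  | |- lt _ _ => apply NNPP; intro
  | |- le _ _ _ => apply NNPP; intro
  | |- ~ _ => intro
  | |- _ => exfalso
  end;
  repeat match goal with
  | H : ~ lt _ _ |- _ => apply wo_not_lt in H
  | H : ~ le _ _ _ |- _ => apply wo_not_le in H
  end;
  wo_saturate.

(** * Infinite cardinals and pairing functions *)

Section Cardinals.
Context {K : wo}.

Lemma card_le_iff (a b : K) :
  card_le K a b <->
  exists f : K -> K, (forall x, x << a -> f x << b) /\ inj_on (fun x => x << a) f.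
Proof.
  split.
  - intros [f finj].
    exists (fun x => match excluded_middle_informative (x << a) with
      | left h => proj1_sig (f (exist _ x h)) | right _ => x end). split.
    + intros x xa. destruct (excluded_middle_informative (x << a)); [|tauto].
      apply (proj2_sig (f (exist _ x l))).
    + intros x y xa ya.
      destruct (excluded_middle_informative (x << a)) as [hx|]; [|tauto].
      destruct (excluded_middle_informative (y << a)) as [hy|]; [|tauto].
      intro e. apply eq_sig_hprop in e; [|intros; apply proof_irrelevance].
      now apply finj, (f_equal (@proj1_sig _ _)) in e.
  - intros [f [fb finj]].
    exists (fun x : seg K a => exist (fun z => z << b) (f (proj1_sig x)) (fb _ (proj2_sig x))).
    intros [x hx] [y hy] e. apply (f_equal (@proj1_sig _ _)) in e; simpl in e.
    apply finj in e; auto. subst. f_equal. apply proof_irrelevance.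
Qed.

Lemma is_infinite_iff (a : K) :
  is_infinite K a <-> exists f : nat -> K, (forall n, f n << a) /\ inj_on (fun _ => True) f.
Proof.
  split.
  - intros [f finj]. exists (fun n => proj1_sig (f n)). split.
    + intro n; apply proj2_sig.
    + intros m n _ _ e. apply finj.
      apply eq_sig_hprop in e; [exact e|intros; apply proof_irrelevance].
  - intros [f [fa finj]]. exists (fun n => exist (fun z => z << a) (f n) (fa n)).
    intros m n e. apply finj; auto. now apply (f_equal (@proj1_sig _ _)) in e.
Qed.

(** Zero counts as a limit, vacuously. *)
Definition limit (a : K) : Prop := forall b, b << a -> exists c, b << c /\ c << a.

Lemma is_infinite_le (a b : K) : is_infinite K a -> card_le K a b -> is_infinite K b.
Proof.
  rewrite !is_infinite_iff, card_le_iff. intros [f [fa finj]] [g [gb ginj]].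
  exists (fun n => g (f n)). split; [auto|].
  intros m n _ _ e. apply finj; auto.
Qed.

Lemma le_card_le (a b : K) : a <<= b -> card_le K a b.
Proof.
  intro ab. apply card_le_iff. exists (fun x => x). split.
  - intros; order.
  - now intros x y _ _ e.
Qed.

(* If [a] were [b + 1], shifting a sequence in [a] by one step and swapping its
   origin with [b] would embed [a] into [b]. *)
Lemma inf_cardinal_limit (a : K) : inf_cardinal K a -> limit a.
Proof.
  intros [acard ainf] b ba. apply NNPP; intro no.
  assert (succ : forall x, x << a -> x <> b -> x << b).
  { intros x xa xb. destruct (lt_total K x b) as [?|[?|?]]; auto; [tauto|].
    exfalso; eauto. }
  apply (acard b ba), card_le_iff.
  apply is_infinite_iff in ainf. destruct ainf as [f [fa finj]].
  assert (Hh : exists h : K -> K, (forall x, x << a -> h x << a) /\ inj_on (fun x => x << a) h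
     /\ forall x, x << a -> h x <> f 0).
  { assert (Hc : forall x, exists v, (exists n, x = f n /\ v = f (S n)) \/
              (~ (exists n, x = f n)) /\ v = x).
    { intro x. destruct (classic (exists n, x = f n)) as [[n e]|no'].
      - exists (f (S n)); eauto.
      - exists x; eauto. }
    apply choice in Hc. destruct Hc as [h Hh]. exists h. split; [|split].
    - intros x xa. destruct (Hh x) as [[n [-> ->]]|[_ ->]]; auto.
    - intros x y xa ya e.
      destruct (Hh x) as [[n [ex ex']]|[nx ex']]; destruct (Hh y) as [[m [ey ey']]|[ny ey']].
      + rewrite ex', ey' in e. apply finj in e; auto. injection e as ->. congruence.
      + exfalso; apply ny. exists (S n). congruence.
      + exfalso; apply nx. exists (S m). congruence.
      + congruence.
    - intros x xa e. destruct (Hh x) as [[n [_ e']]|[nx e']].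
      + rewrite e' in e. apply finj in e; auto. discriminate.
      + apply nx. exists 0. congruence. }
  destruct Hh as [h [ha [hinj h0]]].
  assert (Hc : forall x, exists v, (h x = b /\ v = f 0) \/ (h x <> b /\ v = h x)).
  { intro x. destruct (classic (h x = b)); eauto. }
  apply choice in Hc. destruct Hc as [k Hk]. exists k. split.
  - intros x xa. destruct (Hk x) as [[e ->]|[e ->]].
    + apply succ; auto. rewrite <- e. intro e'. now apply (h0 x xa).
    + auto.
  - intros x y xa ya e.
    destruct (Hk x) as [[ex kx]|[ex kx]]; destruct (Hk y) as [[ey ky]|[ey ky]];
      apply hinj; auto; try congruence.
    + exfalso. apply (h0 y ya). congruence.
    + exfalso. apply (h0 x xa). congruence.
Qed.

Definition pairing (p : K -> K -> K) (a : K) : Prop :=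
  (forall x y, x << a -> y << a -> p x y << a) /\
  (forall x y x' y', x << a -> y << a -> x' << a -> y' << a ->
     p x y = p x' y' -> x = x' /\ y = y').

(* Hessenberg's theorem [a * a = a], via the Goedel well-ordering of pairs
   (by maximum, then lexicographically). *)
Lemma infinite_pairing (a : K) : is_infinite K a -> exists p, pairing p a.
Proof.
  induction a as [a IH] using (well_founded_ind (lt_wf K)). intro ainf.
  (* A non-cardinal inherits the pairing of a smaller segment into which it embeds. *)
  destruct (classic (exists b, b << a /\ card_le K a b)) as [[b [ba ab]]|acard].
  { destruct (IH b ba (is_infinite_le a b ainf ab)) as [p [pb pinj]].
    apply card_le_iff in ab. destruct ab as [f [fb finj]].
    exists (fun x y => p (f x) (f y)). split.
    - intros x y xa ya. pose proof (pb _ _ (fb x xa) (fb y ya)). order.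
    - intros x y x' y' xa ya xa' ya' e. apply pinj in e; auto.
      destruct e as [e1 e2]. split; apply finj; auto. }
  assert (alim : limit a).
  { apply inf_cardinal_limit. split; [|exact ainf]. intros b ba ab; eauto. }
  destruct (classic (exists w, w << a /\ is_infinite K w)) as [[w [wa winf]]|nw].
  - assert (Hm : exists mx : K * K -> K, forall q,
       (mx q = fst q \/ mx q = snd q) /\ fst q <<= mx q /\ snd q <<= mx q).
    { apply choice with (R := fun q z => (z = fst q \/ z = snd q) /\ fst q <<= z /\ snd q <<= z).
      intro q; apply wo_max. }
    destruct Hm as [mx Hm].
    pose (mu := fun q : K * K => (mx q, q)).
    pose (R0 := slexprod _ _ (@lt K) (slexprod _ _ (@lt K) (@lt K))).
    pose (R := fun q q' => R0 (mu q) (mu q') /\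
       fst q << a /\ snd q << a /\ fst q' << a /\ snd q' << a).
    assert (Rwf : well_founded R).
    { apply (wf_incl _ _ (fun q q' => R0 (mu q) (mu q'))); [now intros q q' [? _]|].
      apply wf_inverse_image. repeat apply wf_slexprod; apply (lt_wf K). }
    assert (Rtot : forall q q', fst q << a -> snd q << a -> fst q' << a -> snd q' << a ->
       R q q' \/ q = q' \/ R q' q).
    { intros q q' h1 h2 h3 h4. destruct q as [x y], q' as [x' y']. unfold R, R0, mu; simpl in *.
      destruct (lt_total K (mx (x,y)) (mx (x',y'))) as [?|[e|?]].
      - left; repeat split; auto. now constructor.
      - rewrite e. destruct (lt_total K x x') as [?|[<-|?]].
        + left; repeat split; auto. constructor 2. now constructor.
        + destruct (lt_total K y y') as [?|[<-|?]]; auto.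
          * left; repeat split; auto. constructor 2. now constructor 2.
          * right; right; repeat split; auto. constructor 2. now constructor 2.
        + right; right; repeat split; auto. constructor 2. now constructor.
      - right; right; repeat split; auto. now constructor. }
    (* If at some [q] all values below [a] were taken, the predecessors of [q] would embed [a] into
       the pairs below some infinite [m << a], hence by induction into [m], against [acard]. *)
    assert (Hgr : exists F : K * K -> K, forall q, F q << a /\ forall q', R q' q -> F q' <> F q).
    { apply (greedy _ _ w (fun v => v << a) R Rwf). intros q f.
      apply NNPP; intro no.
      assert (all : forall v, exists q', v << a -> R q' q /\ f q' = v).
      { intro v. apply NNPP; intro nv. apply no. exists v.
        assert (va : v << a) by (apply NNPP; intro; apply nv; exists q; tauto).
        split; [exact va|]. intros q' Rq e. apply nv. exists q'. auto. }
      apply choice in all. destruct all as [g Hg].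
      assert (qa : mx q << a).
      { destruct (Hg w wa) as [Rw _]. destruct Rw as [_ [_ [_ [? ?]]]].
        destruct (Hm q) as [[-> | ->] _]; auto. }
      destruct (wo_max w (mx q)) as [m0 [m0e [wm qm]]].
      assert (m0a : m0 << a) by (destruct m0e; subst; auto).
      destruct (alim m0 m0a) as [m [m0m ma]].
      assert (minf : is_infinite K m).
      { apply (is_infinite_le w); [exact winf|]. apply le_card_le. order. }
      destruct (IH m ma minf) as [p [pm pinj]].
      assert (Hlt : forall v, v << a -> fst (g v) << m /\ snd (g v) << m).
      { intros v va. destruct (Hg v va) as [[Rv _] _].
        destruct (Hm (g v)) as [_ [h1 h2]].
        assert (mx (g v) <<= mx q).
        { unfold R0, mu in Rv. inversion Rv; subst; [now left| now right]. }
        split; order. }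
      apply acard. exists m. split; [exact ma|]. apply card_le_iff.
      exists (fun v => p (fst (g v)) (snd (g v))). split.
      - intros v va. destruct (Hlt v va). now apply pm.
      - intros v v' va va' e. destruct (Hlt v va), (Hlt v' va').
        apply pinj in e; auto. destruct e as [e1 e2].
        assert (e : g v = g v') by (destruct (g v), (g v'); simpl in *; congruence).
        destruct (Hg v va) as [_ <-], (Hg v' va') as [_ <-]. now rewrite e. }
    destruct Hgr as [F HF]. exists (fun x y => F (x, y)). split.
    + intros; apply HF.
    + intros x y x' y' h1 h2 h3 h4 e.
      destruct (Rtot (x,y) (x',y') h1 h2 h3 h4) as [Rr|[e'|Rr]].
      * exfalso. now apply (proj2 (HF (x',y')) _ Rr).
      * now injection e'.
      * exfalso. now apply (proj2 (HF (x,y)) _ Rr).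
  (* No smaller segment is infinite, so the same greedy choice numbers [a] by naturals and the
     Cantor pairing applies. *)
  - apply is_infinite_iff in ainf. destruct ainf as [f [fa finj]].
    assert (Hgr : exists F : K -> nat, forall x, True /\ forall y, (y << x /\ x << a) -> F y <> F x).
    { apply (greedy _ _ 0 (fun _ => True) (fun y x => y << x /\ x << a)).
      - apply (wf_incl _ _ (@lt K)); [now intros ? ? [? _]|apply lt_wf].
      - intros x g. apply NNPP; intro no.
        assert (all : forall n, exists y, y << x /\ x << a /\ g y = n).
        { intro n. apply NNPP; intro nn. apply no. exists n. split; auto.
          intros y [? ?] e. apply nn. exists y. auto. }
        apply choice in all. destruct all as [h Hh].
        apply nw. exists x. split; [apply (Hh 0)|].
        apply is_infinite_iff. exists h. split; [apply Hh|].
        intros m n _ _ e. destruct (Hh m) as [_ [_ <-]], (Hh n) as [_ [_ <-]]. now rewrite e. }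
    destruct Hgr as [F HF].
    assert (Finj : forall x y, x << a -> y << a -> F x = F y -> x = y).
    { intros x y xa ya e. destruct (lt_total K x y) as [?|[?|?]]; auto.
      - exfalso. now apply (proj2 (HF y) x).
      - exfalso. now apply (proj2 (HF x) y). }
    exists (fun x y => f (to_nat (F x, F y))). split; [auto|].
    intros x y x' y' h1 h2 h3 h4 e. apply finj in e; auto.
    apply (f_equal of_nat) in e. rewrite !cancel_of_to in e. injection e as e1 e2.
    split; apply Finj; auto.
Qed.

End Cardinals.

(** * Cofinalities and maps between points of equal cofinality *)

Section Cofinality.
Context {K : wo}.

Lemma ordertype_is_iff (A : K -> Prop) (t : K) :
  ordertype_is K A t <->
  exists g : K -> K, (forall x y, x << y -> y << t -> g x << g y) /\
    (forall z, A z <-> exists x, x << t /\ g x = z).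
Proof.
  split.
  - intros [g [gmono gA]].
    exists (fun x => match excluded_middle_informative (x << t) with
      | left h => g (exist _ x h) | right _ => x end). split.
    + intros x y xy yt. pose proof (lt_trans _ _ _ _ xy yt) as xt.
      destruct (excluded_middle_informative (x << t)); [|tauto].
      destruct (excluded_middle_informative (y << t)); [|tauto].
      now apply gmono.
    + intro z. rewrite gA. split.
      * intros [[x h] <-]. exists x. split; [exact h|].
        destruct (excluded_middle_informative (x << t)); [|tauto].
        do 2 f_equal. apply proof_irrelevance.
      * intros [x [h <-]]. destruct (excluded_middle_informative (x << t)); [|tauto]. eauto.
  - intros [g [gmono gA]]. exists (fun x => g (proj1_sig x)). split.
    + intros [x hx] [y hy]; simpl; auto.
    + intro z. rewrite gA. split.
      * intros [x [h <-]]. now exists (exist _ x h).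
      * intros [[x h] <-]. now exists x.
Qed.

Lemma cof_unique (a t t' : K) : cof K a t -> cof K a t' -> t = t'.
Proof.
  intros [h1 h2] [h3 h4]. destruct (lt_total K t t') as [?|[?|?]]; auto.
  - exfalso; now apply (h4 t).
  - exfalso; now apply (h2 t').
Qed.

(** Convergence of [tau x] to [a'] as [x] tends to [a]; asking for no monotonicity lets such maps be
    built by arbitrary choices. *)
Definition converges (tau : K -> K) (a a' : K) : Prop :=
  (forall x, x << a -> tau x << a') /\
  (forall b, b << a' -> exists d, d << a /\ forall x, d <<= x -> x << a -> b <<= tau x).

(** With cofinal sequences [g] and [g'] of the same length, [x] goes to [g' k] for any [k] with
    [x <<= g k]; once [x] passes [g k0], such a [k] is at least [k0]. *)
Lemma same_cof_converges (a a' t : K) :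
  cof K a t -> cof K a' t -> exists tau, converges tau a a'.
Proof.
  intros [[A [[Aa Acof] At]] _] [[A' [[Aa' Acof'] At']] _].
  apply ordertype_is_iff in At, At'.
  destruct At as [g [gmono gA]], At' as [g' [gmono' gA']].
  assert (Hc : forall x, exists v, x << a -> exists k, k << t /\ x <<= g k /\ v = g' k).
  { intro x. destruct (classic (x << a)) as [xa|]; [|now exists x].
    destruct (Acof x xa) as [z [Az xz]]. apply gA in Az. destruct Az as [k [kt <-]].
    exists (g' k). eauto. }
  apply choice in Hc. destruct Hc as [tau Htau]. exists tau. split.
  - intros x xa. destruct (Htau x xa) as [k [kt [_ ->]]]. apply Aa', gA'. eauto.
  - intros b ba'. destruct (Acof' b ba') as [z [Az bz]].
    apply gA' in Az. destruct Az as [k0 [k0t <-]].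
    exists (g k0). split; [apply Aa, gA; eauto|].
    intros x dx xa. destruct (Htau x xa) as [k [kt [xk ->]]].
    destruct (wo_le_or_lt k0 k) as [[k0k| ->]|kk0].
    + pose proof (gmono' _ _ k0k kt). order.
    + exact bz.
    + pose proof (gmono _ _ kk0 k0t). order.
Qed.

Lemma sup_is_limit (B : K -> Prop) (a : K) : sup_is K B a -> limit a.
Proof. intros [Ba Bcof] b ba. destruct (Bcof b ba) as [x [Bx bx]]. eauto. Qed.

(** A last element [b] below [a] would make [tau b] an upper bound of the points below [a']. *)
Lemma converges_limit (tau : K -> K) (a a' : K) : converges tau a a' -> limit a' -> limit a.
Proof.
  intros [taua taucof] lim' b ba.
  apply NNPP; intro no.
  destruct (lim' (tau b) (taua b ba)) as [c [bc ca]].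
  destruct (taucof c ca) as [d [da Hd]].
  assert (db : d <<= b) by (apply wo_not_lt; eauto).
  pose proof (Hd b db ba). order.
Qed.

Lemma limit_sup_is (a : K) (P : K -> Prop) (c : K) :
  limit a -> c << a -> (forall x, P x <-> c << x /\ x << a) -> sup_is K P a.
Proof.
  intros lim ca HP. split.
  - intros x Px. apply HP in Px; tauto.
  - intros b ba. destruct (wo_max b c) as [m [me [bm cm]]].
    assert (ma : m << a) by (destruct me; subst; auto).
    destruct (lim m ma) as [x [mx xa]]. exists x. rewrite HP. repeat split; order.
Qed.

Lemma regressive_choice (a : K) (D : K -> Prop) (P : K -> K -> Prop) :
  (forall x, D x -> exists v, v << x /\ P x v) ->
  exists f, regressive_on K f a /\ forall x, D x -> P x (f x).
Proof.
  intro H.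
  assert (Hc : forall x, exists v, (x << a -> v << a) /\ ((exists c, c << x) -> v << x) /\
     (D x -> P x v)).
  { intro x. destruct (classic (D x)) as [Dx|].
    - destruct (H x Dx) as [v [vx Pv]]. exists v. repeat split; auto.
      eauto using lt_trans.
    (* Outside [D] any smaller point is a default; the least point keeps itself, as [regressive_on]
       allows. *)
    - destruct (classic (exists c, c << x)) as [[c cx]|].
      + exists c. repeat split; eauto using lt_trans; tauto.
      + exists x. tauto. }
  apply choice in Hc. destruct Hc as [f Hf]. exists f. split.
  - intros b ba. destruct (Hf b) as [h1 [h2 _]]. auto.
  - intro x. apply Hf.
Qed.

Lemma cardinal_no_inj (l m : K) (f : K -> K) : is_cardinal K l -> m << l ->
  (forall x, x << l -> f x << m) -> inj_on (fun x => x << l) f -> False.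
Proof. intros lc ml fm finj. apply (lc m ml), card_le_iff. eauto. Qed.

Lemma club_above (C : K -> Prop) (c : K) : club K C -> club K (fun x => C x /\ c << x).
Proof.
  intros [Cunb Ccl]. split.
  - intro b. destruct (wo_max b c) as [m [_ [bm cm]]]. destruct (Cunb m) as [x [Cx mx]].
    exists x. repeat split; auto; order.
  - intros a [b0 b0a] H. split.
    + apply Ccl; [eauto|]. intros b ba. destruct (H b ba) as [x [[? ?] ?]]. eauto.
    + destruct (H b0 b0a) as [x [[? ?] [? ?]]]. eauto using lt_trans.
Qed.

Lemma cofinal_in_sup_is (A : K -> Prop) (a : K) : limit a -> cofinal_in K A a -> sup_is K A a.
Proof.
  intros lim [Aa Acof]. split; [exact Aa|]. intros b ba.
  destruct (lim b ba) as [c [bc ca]]. destruct (Acof c ca) as [x [Ax cx]].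
  exists x. split; [exact Ax|order].
Qed.

End Cofinality.

(** * Order types of subsets and bounds below a regular cardinal *)

Section RegularBounds.
Context {K : wo}.

(** [h u] is the least element of [R] above all earlier values. As [h u] is at least [u], this stops
    by stage [t]; an element of [R] never reached would still be available at the stop. *)
Lemma ordertype_of_subset (R : K -> Prop) (t : K) : (forall x, R x -> x << t) ->
  exists t', t' <<= t /\ ordertype_is K R t'.
Proof.
  intro Rt.
  pose (above := fun u (h : K -> K) v => R v /\ forall u', u' << u -> h u' << v).
  destruct (wf_choice K K t (@lt K) (fun u h v => (exists v', above u h v') ->
     above u h v /\ forall v', above u h v' -> v <<= v')) as [h Hh].
  - apply lt_wf.
  - intros u h h' v E H Hex.
    assert (Ha : forall v', above u h' v' <-> above u h v').
    { intro v'. unfold above. split; intros [? H']; split; auto; intros u' uu';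
        [rewrite E | rewrite <- E]; auto. }
    setoid_rewrite Ha. apply H. destruct Hex as [v' ?]. exists v'. now apply Ha.
  - intros u h. destruct (classic (exists v', above u h v')) as [ex|no].
    + destruct (wo_least _ ex) as [v Hv]. exists v. auto.
    + exists t. tauto.
  - assert (Hex : exists u, u <<= t /\ ~ exists v, above u h v).
    { apply NNPP; intro no.
      assert (all : forall u, u <<= t -> exists v, above u h v).
      { intros u ut. apply NNPP; intro nv. apply no; eauto. }
      assert (inc : forall u, u <<= t -> u <<= h u).
      { intro u. induction u as [u IH] using (well_founded_ind (lt_wf K)). intro ut.
        apply wo_not_lt. intro hu. destruct (Hh u (all u ut)) as [[_ H] _].
        pose proof (H _ hu). assert (h u <<= h (h u)); [|order]. apply IH; [auto|order]. }
      destruct (Hh t (all t (wo_le_refl t))) as [[H _] _].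
      pose proof (Rt _ H). pose proof (inc t (wo_le_refl t)). order. }
    destruct (wo_least _ Hex) as [t' [[t't not'] tmin]].
    assert (cand : forall u, u << t' -> exists v, above u h v).
    { intros u ut. apply NNPP; intro nv. assert (t' <<= u); [|order].
      apply tmin. split; [order|exact nv]. }
    exists t'. split; [exact t't|]. apply ordertype_is_iff. exists h. split.
    + intros x y xy yt. destruct (Hh y (cand y yt)) as [[_ H] _]. auto.
    + intro z. split.
      * intro Rz. apply NNPP; intro nx. apply not'. exists z. split; [exact Rz|].
        intro u. induction u as [u IH] using (well_founded_ind (lt_wf K)). intro ut.
        destruct (Hh u (cand u ut)) as [_ H].
        destruct (H z) as [?|E]; [|assumption|exfalso; eauto].
        split; [exact Rz|]. intros u' uu'. apply IH; eauto using lt_trans.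
      * intros [x [xt <-]]. apply (Hh x (cand x xt)).
Qed.

(** If [phi] were unbounded, its strict records, at the indices in [rec], would be cofinal in [lam]:
    the first index reaching a bound [b] is a record. Records increase, so their order type is at
    most [t]. *)
Lemma regular_bounded (lam t : K) (A : K -> Prop) (phi : K -> K) :
  regular K lam -> t << lam -> ordertype_is K A t -> (forall x, A x -> phi x << lam) ->
  exists m, m << lam /\ forall x, A x -> phi x << m.
Proof.
  intros [_ reg] tl At philam. apply NNPP; intro no.
  apply ordertype_is_iff in At. destruct At as [g [gmono gA]].
  pose (rec := fun k => k << t /\ forall k', k' << k -> phi (g k') << phi (g k)).
  destruct (ordertype_of_subset rec t) as [t' [t't Hrec]]; [now intros x [? _]|].
  apply ordertype_is_iff in Hrec. destruct Hrec as [h [hmono hrec]].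
  assert (t'l : t' << lam) by order.
  apply (reg t' t'l). exists (fun v => exists k, rec k /\ phi (g k) = v). split.
  - split.
    + intros v [k [[kt _] <-]]. apply philam, gA. eauto.
    + intros b bl.
      destruct (wo_least (fun k => k << t /\ b <<= phi (g k))) as [k [[kt bk] kmin]].
      { apply NNPP; intro nk. apply no. exists b. split; [exact bl|].
        intros x Ax. apply gA in Ax. destruct Ax as [k [kt <-]].
        apply wo_not_le. intro. apply nk. eauto. }
      exists (phi (g k)). split; [|exact bk]. exists k. split; [|reflexivity].
      split; [exact kt|]. intros k' k'k. apply wo_lt_le_trans with b; [|exact bk].
      apply wo_not_le. intro bk'. assert (k <<= k'); [|order].
      apply kmin. split; [order|exact bk'].
  - apply ordertype_is_iff. exists (fun u => phi (g (h u))). split.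
    + intros x y xy yt.
      assert (Ry : rec (h y)) by (apply hrec; eauto). apply Ry. auto.
    + intro v. split.
      * intros [k [rk <-]]. apply hrec in rk. destruct rk as [x [xt <-]]. eauto.
      * intros [x [xt <-]]. exists (h x). split; [|reflexivity]. apply hrec. eauto.
Qed.

Lemma regular_union_bounded (lam t : K) (A : K -> Prop) (P : K -> K -> Prop) :
  regular K lam -> t << lam -> ordertype_is K A t ->
  (forall x, A x -> exists m, m << lam /\ forall v, P x v -> v << m) ->
  exists m, m << lam /\ forall x v, A x -> P x v -> v << m.
Proof.
  intros reg tl At H.
  assert (Hc : forall x, exists m, A x -> m << lam /\ forall v, P x v -> v << m).
  { intro x. destruct (classic (A x)) as [Ax|]; [|now exists x].
    destruct (H x Ax) as [m ?]; eauto. }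
  apply choice in Hc. destruct Hc as [phi Hphi].
  destruct (regular_bounded lam t A phi reg tl At) as [m [ml Hm]].
  { intros x Ax. now apply Hphi. }
  exists m. split; [exact ml|]. intros x v Ax Pv.
  destruct (Hphi x Ax) as [_ h]. pose proof (h v Pv). pose proof (Hm x Ax). order.
Qed.

End RegularBounds.

(** * Carrying guesses from [astar] to other points of cofinality [theta] *)

Section Transfer.
Context {K : wo} {theta lam : K} {e : K -> K -> K} {astar : K} {fs : K -> K -> K -> Prop}.
Hypothesis theta_inf : is_infinite K theta.
Hypothesis lam_card : inf_cardinal K lam.
Hypothesis theta_lam : theta << lam.
Hypothesis e_lam : forall b x, x << b -> e b x << lam.
Hypothesis e_inj : forall b, inj_on (fun x => x << b) (e b).
Hypothesis lam_astar : lam << astar.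
Hypothesis cof_astar : cof K astar theta.
Hypothesis fs_small : forall i x, small2 K (fs i x).
Hypothesis fs_guess : forall f, regressive_on K f astar -> forall B, sup_is K B astar ->
  exists i, i << astar /\ sup_is K (fun x => B x /\ fs i x (f x)) astar.

Lemma astar_limit (a : K) : cof K a theta -> limit a -> limit astar.
Proof.
  intros ca lim. destruct (same_cof_converges _ _ _ cof_astar ca) as [tau Htau].
  now apply (converges_limit tau _ a).
Qed.

(* If the conclusion fails, then [theta] and [lam] have the same cofinality, and a function
   [astar -> lam] can be diagonalized against the [lam] many functions guessing at [astar]. *)
Lemma bounded_on_cofinal (a : K) (G : K -> Prop) (phi : K -> K) :
  cof K a theta -> sup_is K G a -> (forall g, G g -> phi g << lam) ->
  exists i, i << lam /\ sup_is K (fun g => G g /\ phi g << i) a.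
Proof.
  intros ca Ga philam. apply NNPP; intro no.
  pose proof (sup_is_limit _ _ Ga) as alim. pose proof (astar_limit a ca alim) as aslim.
  assert (Hbd : forall i, i << lam -> exists d, d << a /\ forall g, G g -> d << g -> i <<= phi g).
  { intros i il. apply NNPP; intro nd. apply no. exists i. split; [exact il|]. split.
    - intros g [Gg _]. now apply Ga.
    - intros b ba. apply NNPP; intro nx. apply nd. exists b. split; [exact ba|].
      intros g Gg bg. apply wo_not_lt. intro gi. apply nx; eauto. }
  destruct (same_cof_converges _ _ _ cof_astar ca) as [tau [taua taucof]].
  (* [psi] moves [phi] from [a] to [astar], where it still eventually reaches each [i] below
     [lam]. *)
  assert (Hpsi : forall x, exists v, x << astar -> exists g, G g /\ tau x << g /\ v = phi g).
  { intro x. destruct (classic (x << astar)) as [xa|]; [|now exists x].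
    destruct (proj2 Ga _ (taua x xa)) as [g [Gg tg]]. exists (phi g). eauto. }
  apply choice in Hpsi. destruct Hpsi as [psi Hpsi].
  (* [f x] is a value below [lam], hence below [x], missed by all [fs i x] with
     [e astar i <<= psi x]: these are fewer than [lam] sets with at most one element each. *)
  destruct (regressive_choice astar (fun x => lam << x /\ x << astar)
     (fun x v => forall i, i << astar -> e astar i <<= psi x -> ~ fs i x v)) as [f [freg Hf]].
  { intros x [lx xa]. apply NNPP; intro nv.
    assert (all : forall v, exists i, v << lam ->
        i << astar /\ e astar i <<= psi x /\ fs i x v).
    { intro v. destruct (classic (v << lam)) as [vl|]; [|now exists v].
      apply NNPP; intro ni. apply nv. exists v. split; [order|].
      intros i ia ei fi. apply ni. exists i; auto. }
    apply choice in all. destruct all as [k Hk].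
    assert (psil : psi x << lam).
    { destruct (Hpsi x xa) as [g [Gg [_ ->]]]. auto. }
    destruct (inf_cardinal_limit lam lam_card _ psil) as [m [pm ml]].
    apply (cardinal_no_inj lam m (fun v => e astar (k v)) (proj1 lam_card) ml).
    - intros v vl. destruct (Hk v vl) as [? [? ?]]. order.
    - intros v v' vl vl' E. destruct (Hk v vl) as [? [? h]], (Hk v' vl') as [? [? h']].
      apply e_inj in E; auto. rewrite E in h. exact (fs_small _ _ _ _ h h'). }
  destruct (fs_guess f freg (fun x => lam << x /\ x << astar)) as [i [ia [_ Hi]]].
  { now apply (limit_sup_is astar _ lam). }
  (* From some point on [e astar i <<= psi x], so [f] avoids the guesses of this [i]. *)
  destruct (Hbd (e astar i) (e_lam _ _ ia)) as [d [da Hd]].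
  destruct (taucof d da) as [d' [d'a Hd']].
  destruct (Hi d' d'a) as [x [[xx fx] d'x]].
  apply (Hf x xx i ia); [|exact fx].
  destruct xx as [lx xa]. destruct (Hpsi x xa) as [g [Gg [tg ->]]].
  apply Hd; [exact Gg|]. assert (d <<= tau x) by (apply Hd'; [now left|exact xa]). order.
Qed.

(** Since [Y] takes each value boundedly often, it tends to its lower limit [d] along a cofinal set
    of points [b = bt g], and there [q d (Y b)] tends to [astar]. Coding [f b] by [e b (f b)], which
    is below [lam], gives a regressive function at [astar] whose guess pulls back to [a]. *)
Lemma guess_through_converging (q : K -> K -> K) :
  (forall d, (exists tau, converges tau d astar) -> converges (q d) d astar) ->
  forall (a : K) (G : K -> Prop) (bt Y f : K -> K),
  cof K a theta -> sup_is K G a -> (forall g, G g -> g << bt g /\ bt g << a) ->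
  (forall x, Y x << lam) ->
  (forall g, G g -> exists d, d << a /\ forall g', G g' -> d << g' -> Y (bt g') <> Y (bt g)) ->
  regressive_on K f a ->
  exists d i, d << lam /\ i << astar /\
    sup_is K (fun b => (exists g, G g /\ b = bt g) /\ f b << b /\
      fs i (q d (Y b)) (e b (f b))) a.
Proof.
  intros Hq a G bt Y f ca Ga Hbt Ylam Yfib freg.
  pose proof (sup_is_limit _ _ Ga) as alim. pose proof (astar_limit a ca alim) as aslim.
  destruct (wo_least (fun d => d << lam /\ sup_is K (fun g => G g /\ Y (bt g) << d) a))
    as [d [[dl [_ Gd]] dmin]].
  { apply bounded_on_cofinal; auto. }
  (* Values below [v] occur boundedly by minimality of [d], the value [v] itself by [Yfib]. *)
  assert (Hbd : forall v, exists c, v << d ->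
     c << a /\ forall g, G g -> Y (bt g) <<= v -> g <<= c).
  { intro v. destruct (classic (v << d)) as [vd|]; [|now exists v].
    assert (H1 : exists c, c << a /\ forall g, G g -> Y (bt g) << v -> g <<= c).
    { apply NNPP; intro no.
      assert (vl : v << lam) by order.
      assert (d <<= v); [|order]. apply dmin. split; [exact vl|]. split.
      - intros g [Gg _]. now apply Ga.
      - intros b ba. apply NNPP; intro nx. apply no. exists b. split; [exact ba|].
        intros g Gg gv. apply wo_not_lt. intro bg. apply nx; eauto. }
    assert (H2 : exists c, c << a /\ forall g, G g -> Y (bt g) = v -> g <<= c).
    { destruct (classic (exists g, G g /\ Y (bt g) = v)) as [[g [Gg gv]]|no].
      - destruct (Yfib g Gg) as [c [ca' Hc]]. exists c. split; [exact ca'|].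
        intros g' Gg' gv'. apply wo_not_lt. intro cg. apply (Hc g' Gg' cg). congruence.
      - destruct H1 as [c [? _]]. exists c. split; [auto|]. intros g Gg gv. exfalso; eauto. }
    destruct H1 as [c1 [c1a H1]], H2 as [c2 [c2a H2]].
    destruct (wo_max c1 c2) as [c [ce [? ?]]]. exists c. intros _.
    split; [destruct ce; subst; auto|].
    intros g Gg [gv|gv]; [pose proof (H1 g Gg gv)|pose proof (H2 g Gg gv)]; order. }
  apply choice in Hbd. destruct Hbd as [bd Hbd].
  destruct (same_cof_converges _ _ _ ca cof_astar) as [tau [taua taucof]].
  (* [Hq] asks for some map converging from [d] to [astar]: [bd] tends to [a] along [d], and [tau]
     leads on to [astar]. *)
  destruct (Hq d) as [qa qcof].
  { exists (fun v => tau (bd v)). split.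
    - intros v vd. apply taua, Hbd, vd.
    - intros b ba. destruct (taucof b ba) as [c [ca' Hc]].
      destruct (Gd c ca') as [g [[Gg gd] cg]]. exists (Y (bt g)). split; [exact gd|].
      intros v gv vd. destruct (Hbd v vd) as [? h]. apply Hc; [|auto].
      pose proof (h g Gg gv). order. }
  pose (w := fun g => q d (Y (bt g))).
  pose (G1 := fun g => G g /\ Y (bt g) << d).
  assert (wa : forall g, G1 g -> w g << astar) by (intros g [_ gd]; now apply qa).
  assert (wcof : forall b, b << astar -> exists c, c << a /\
     forall g, G1 g -> c << g -> b << w g).
  { intros b ba. destruct (aslim b ba) as [b' [bb' b'a]].
    destruct (qcof b' b'a) as [v [vd Hv]]. exists (bd v). split; [apply Hbd, vd|].
    intros g [Gg gd] cg. assert (b' <<= w g); [|order]. apply Hv; [|exact gd].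
    destruct (Hbd v vd) as [_ h]. left. apply wo_not_le. intro gv.
    pose proof (h g Gg gv). order. }
  (* Points from which [w] never drops again are cofinal, and [w] is monotone on them. *)
  pose (G2 := fun g => G1 g /\ forall g', G1 g' -> g << g' -> w g <<= w g').
  assert (G2cof : forall b, b << a -> exists g, G2 g /\ b << g).
  { intros b ba.
    destruct (wo_least (fun x => exists g, G1 g /\ b << g /\ w g = x)) as [x [[g [Gg [bg <-]]] xmin]].
    { destruct (Gd b ba) as [g [? ?]]. exists (w g), g. auto. }
    exists g. split; [|exact bg]. split; [exact Gg|].
    intros g' Gg' gg'. apply xmin. exists g'. repeat split; try apply Gg'. order. }
  (* Many [g] may share the position [x]; [pre x] fixes one of them in [G2]. *)
  assert (Hpre : forall x, exists g, (exists g, G2 g /\ w g = x) -> G2 g /\ w g = x).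
  { intro x. destruct (classic (exists g, G2 g /\ w g = x)) as [[g Hg]|]; eauto.
    now exists x. }
  apply choice in Hpre. destruct Hpre as [pre Hpre].
  pose (D := fun x => lam << x /\ exists g, G2 g /\ w g = x).
  assert (fless : forall g, G g -> f (bt g) << bt g).
  { intros g Gg. destruct (Hbt g Gg) as [gb ba]. apply freg; eauto. }
  (* The code of [f] at the chosen preimage is below [lam], hence below [x]. *)
  destruct (regressive_choice astar D (fun x v => v = e (bt (pre x)) (f (bt (pre x)))))
    as [f' [f'reg Hf']].
  { intros x [lx Hx]. eexists. split; [|reflexivity].
    apply lt_trans with lam; [|exact lx]. apply e_lam, fless. apply (Hpre x Hx). }
  destruct (fs_guess f' f'reg D) as [i [ia [_ Hi]]].
  { split.
    - intros x [_ [g [[Gg _] <-]]]. auto.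
    - intros b ba. destruct (wo_max b lam) as [m [me [bm lm]]].
      assert (ma : m << astar) by (destruct me; subst; auto).
      destruct (wcof m ma) as [c [ca' Hc]]. destruct (G2cof c ca') as [g [Gg cg]].
      pose proof (Hc g (proj1 Gg) cg). exists (w g). split; [split; [order|eauto]|order]. }
  exists d, i. split; [exact dl|]. split; [exact ia|]. split.
  - intros b [[g [Gg ->]] _]. now apply Hbt.
  - intros b ba. destruct (G2cof b ba) as [g' [Gg' bg']].
    destruct (Hi (w g') (wa g' (proj1 Gg'))) as [x [[Dx fx] wx]].
    rewrite (Hf' x Dx) in fx. destruct Dx as [lx Hx].
    destruct (Hpre x Hx) as [Gp wp]. destruct Gp as [[Gp pd] pmono].
    exists (bt (pre x)). destruct (Hbt _ Gp) as [pb _].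
    (* [pre x] is in [G2]: were it below [g'], then [x] would be at most [w g']. *)
    assert (g' <<= pre x).
    { apply wo_not_lt. intro h. pose proof (pmono g' (proj1 Gg') h) as h'.
      rewrite wp in h'. order. }
    split; [|order]. split; [eauto|]. split; [auto|].
    unfold w in wp. now rewrite wp.
Qed.

(** * From separation of points to guessing functions *)

Definition separated (W : K -> K -> K -> Prop) (i i' b' b : K) : Prop :=
  b' << b /\ exists c, W i b c /\ b' << c /\ e c b' << i'.

(** [b'] is determined by [c] and [e c b'], so each [b] forbids fewer than [lam] values. *)
Lemma separating_function (W : K -> K -> K -> Prop) (i i' : K) :
  (forall b, exists m s, m << lam /\ (forall c, W i b c -> s c << m) /\ inj_on (W i b) s) ->
  i' << lam ->
  exists Y : K -> K, forall b, Y b << lam /\ forall b', separated W i i' b' b -> Y b' <> Y b.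
Proof.
  intros Wsmall i'l.
  apply (greedy _ _ lam (fun v => v << lam)).
  { apply (wf_incl _ _ (@lt K)); [now intros ? ? [? _]|apply lt_wf]. }
  intros b f. apply NNPP; intro no.
  assert (all : forall v, exists b' c, v << lam ->
     W i b c /\ b' << c /\ e c b' << i' /\ f b' = v).
  { intro v. destruct (classic (v << lam)) as [vl|]; [|now exists v, v].
    apply NNPP; intro nb. apply no. exists v. split; [exact vl|].
    intros b' [_ [c [? [? ?]]]] ?. apply nb. exists b', c. auto. }
  apply choice in all. destruct all as [b' all].
  apply choice in all. destruct all as [c Hc].
  destruct (Wsmall b) as [m [s [ml [sm sinj]]]].
  destruct (wo_max m i') as [m1 [m1e [? ?]]].
  (* Including [theta] makes [m2] infinite, so that it has a pairing function. *)
  destruct (wo_max m1 theta) as [m2 [m2e [? tm2]]].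
  assert (m2l : m2 << lam) by (destruct m1e, m2e; subst; auto).
  destruct (infinite_pairing m2) as [p [pm pinj]].
  { now apply (is_infinite_le theta), le_card_le. }
  assert (bounds : forall v, v << lam -> s (c v) << m2 /\ e (c v) (b' v) << m2).
  { intros v vl. destruct (Hc v vl) as [h [_ [? _]]]. pose proof (sm _ h). split; order. }
  apply (cardinal_no_inj lam m2 (fun v => p (s (c v)) (e (c v) (b' v))) (proj1 lam_card) m2l).
  - intros v vl. apply pm; now apply bounds.
  - intros v v' vl vl' E. apply pinj in E; try now apply bounds. destruct E as [E1 E2].
    destruct (Hc v vl) as [h1 [h2 [_ <-]]], (Hc v' vl') as [h1' [h2' [_ <-]]].
    apply sinj in E1; auto. rewrite E1 in *. apply e_inj in E2; auto. now rewrite E2.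
Qed.

(** The index of a new guessing function packs the parameters [i], [i'] of [Y], the limit [d], and
    the index [k] of a function guessing at [astar]. *)
Lemma inJ_of_separation (S C : K -> Prop) (W : K -> K -> K -> Prop) :
  subset K S (E K theta) -> club K C ->
  (forall i b, i << lam ->
     exists m s, m << lam /\ (forall c, W i b c -> s c << m) /\ inj_on (W i b) s) ->
  (forall a, S a -> C a -> forall B, sup_is K B a ->
     exists i i' G bt, i << lam /\ i' << lam /\ sup_is K G a /\
       (forall g, G g -> g << bt g /\ bt g << a /\ B (bt g)) /\
       forall g, G g -> exists d, d << a /\
         forall g', G g' -> d << g' -> separated W i i' (bt g) (bt g')) ->
  inJ K S.
Proof.
  intros SE Cclub Wsmall Hsep.
  assert (HY : forall z : K * K, exists Y : K -> K, fst z << lam -> snd z << lam ->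
     forall b, Y b << lam /\ forall b', separated W (fst z) (snd z) b' b -> Y b' <> Y b).
  { intros [i i']; simpl. destruct (classic (i << lam /\ i' << lam)) as [[il i'l]|no].
    - destruct (separating_function W i i') as [Y H]; auto. exists Y; auto.
    - exists (fun x => x). tauto. }
  apply choice in HY. destruct HY as [Y HY].
  (* One converging map per [d], fixed before [a] is known. *)
  assert (Hq : forall d, exists tau, (exists tau, converges tau d astar) -> converges tau d astar).
  { intro d. destruct (classic (exists tau, converges tau d astar)) as [[tau H]|no].
    - now exists tau.
    - exists (fun x => x). tauto. }
  apply choice in Hq. destruct Hq as [q Hq].
  destruct (infinite_pairing lam (proj2 lam_card)) as [p [pl pinj]].
  (* [k] ranges below [astar], so [e astar k] is packed in its place; the code is below [lam], hence
     below every [a] in the club. *)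
  pose (code := fun i i' d k => p (p i i') (p d (e astar k))).
  exists (fun x => C x /\ lam << x). split; [now apply club_above|].
  (* The old function guesses [e b v] at the position of [b]; injectivity of [code] and [e b] leaves
     at most one [v]. *)
  exists (fun j b v => v << b /\ exists i i' d k,
    i << lam /\ i' << lam /\ d << lam /\ k << astar /\ code i i' d k = j /\
    fs k (q d (Y (i, i') b)) (e b v)).
  split.
  - intros j b v v' [vb [i [i' [d [k [h1 [h2 [h3 [h4 [<- h]]]]]]]]]]
      [vb' [i0 [i0' [d0 [k0 [h10 [h20 [h30 [h40 [E h0]]]]]]]]]].
    apply pinj in E; auto. destruct E as [E1 E2].
    apply pinj in E1; auto. apply pinj in E2; auto.
    destruct E1 as [-> ->], E2 as [-> E2]. apply e_inj in E2; auto. subst k0.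
    apply (e_inj b); auto. exact (fs_small _ _ _ _ h h0).
  - intros a Sa [Ca la] f freg B Ba.
    destruct (Hsep a Sa Ca B Ba) as [i [i' [G [bt [il [i'l [Ga [Hbt Hg]]]]]]]].
    specialize (HY (i, i') il i'l); simpl in HY.
    destruct (guess_through_converging q Hq a G bt (Y (i, i')) f) as [d [k [dl [ka [_ Hk]]]]]; auto.
    + now apply SE.
    + intros g Gg. destruct (Hbt g Gg) as [? [? ?]]; auto.
    + intro x. apply HY.
    + intros g Gg. destruct (Hg g Gg) as [d [da Hd]]. exists d. split; [exact da|].
      intros g' Gg' dg' E. now apply (proj2 (HY (bt g')) (bt g)); [apply Hd|].
    + exists (code i i' d k). split.
      { apply lt_trans with lam; [|exact la]. unfold code. auto. }
      split.
      * intros b [Bb _]. now apply Ba.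
      * intros c ca. destruct (Hk c ca) as [b [[[g [Gg ->]] [fb Hf]] cb]].
        exists (bt g). split; [|exact cb]. split; [now apply Hbt|]. split; [exact fb|].
        exists i, i', d, k. repeat split; auto.
Qed.

(** * Separation at approachable points and for regular [lam] *)

Lemma inJ_of_inI (S : K -> Prop) : subset K S (E K theta) -> inI K S -> inJ K S.
Proof.
  intros SE [a_ [_ [C [Cclub Happ]]]].
  pose (small := fun X : K -> Prop => exists s, (forall x, X x -> s x << theta) /\ inj_on X s).
  pose (W := fun i b c => exists d, d << b /\ e b d << i /\ small (a_ d) /\ a_ d c).
  refine (inJ_of_separation S C W SE Cclub _ _).
  - intros i b il.
    (* The code of [d] paired with the place of [c] in [a_ d] embeds [W i b] into the larger of [i]
       and [theta]. *)
    destruct (wo_max i theta) as [m [me [im tm]]].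
    assert (ml : m << lam) by (destruct me; subst; auto).
    destruct (infinite_pairing m) as [p [pm pinj]].
    { now apply (is_infinite_le theta), le_card_le. }
    assert (Hd : forall c, exists d, W i b c -> d << b /\ e b d << i /\ small (a_ d) /\ a_ d c).
    { intro c. destruct (classic (W i b c)) as [[d Hd]|]; eauto. now exists c. }
    apply choice in Hd. destruct Hd as [dd Hd].
    assert (Hs : forall d, exists s, small (a_ d) ->
       (forall x, a_ d x -> s x << theta) /\ inj_on (a_ d) s).
    { intro d. destruct (classic (small (a_ d))) as [[s Hs]|]; eauto.
      exists (fun x => x); tauto. }
    apply choice in Hs. destruct Hs as [s Hs].
    exists m, (fun c => p (e b (dd c)) (s (dd c) c)). split; [exact ml|].
    assert (bounds : forall c, W i b c -> e b (dd c) << m /\ s (dd c) c << m).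
    { intros c Wc. destruct (Hd c Wc) as [_ [? [sm ac]]].
      destruct (Hs _ sm) as [h _]. pose proof (h c ac). split; order. }
    split.
    + intros c Wc. apply pm; now apply bounds.
    + intros c c' Wc Wc' E. apply pinj in E; try now apply bounds.
      destruct E as [E1 E2].
      destruct (Hd c Wc) as [h1 [_ [sm ac]]], (Hd c' Wc') as [h1' [_ [_ ac']]].
      apply e_inj in E1; auto. rewrite <- E1 in *. now apply (Hs _ sm) in E2.
  - intros a Sa Ca B Ba.
    destruct (Happ a Sa Ca) as [A [Acof [[t [ct At]] Hinit]]].
    pose proof (SE a Sa) as cta. rewrite (cof_unique _ _ _ ct cta) in At.
    pose proof (sup_is_limit _ _ Ba) as alim.
    pose proof (cofinal_in_sup_is A a alim Acof) as Asup.
    assert (Hsmall : forall d g, (forall x, a_ d x <-> A x /\ x << g) -> small (a_ d)).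
    { apply ordertype_is_iff in At. destruct At as [gA [gmono HgA]]. intros d g Hdg.
      assert (Hs : forall x, exists k, A x -> k << theta /\ gA k = x).
      { intro x. destruct (classic (A x)) as [Ax|]; [|now exists x].
        apply HgA in Ax. destruct Ax as [k ?]; eauto. }
      apply choice in Hs. destruct Hs as [s Hs]. exists s. split.
      - intros x ax. apply Hdg in ax. apply Hs, ax.
      - intros x y ax ay E. apply Hdg in ax, ay.
        destruct (Hs x (proj1 ax)) as [_ <-], (Hs y (proj1 ay)) as [_ <-]. now rewrite E. }
    assert (Hb : forall g, exists bb, g << a ->
        bb << a /\ forall x, a_ bb x <-> A x /\ x << g).
    { intro g. destruct (classic (g << a)) as [ga|]; [|now exists g].
      destruct (Hinit g ga) as [bb ?]; eauto. }
    apply choice in Hb. destruct Hb as [bb Hbb].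
    (* [bt g] lies above the index [bb g], so [e (bt g)] assigns a code to the initial segment of
       [A] below [g]. *)
    assert (Hbt : forall g, exists bt, g << a -> B bt /\ g << bt /\ bb g << bt /\ bt << a).
    { intro g. destruct (classic (g << a)) as [ga|]; [|now exists g].
      destruct (wo_max g (bb g)) as [m [me [? ?]]].
      assert (ma : m << a) by (destruct (Hbb g ga); destruct me; subst; auto).
      destruct (proj2 Ba m ma) as [bt [Bbt mbt]]. exists bt. intros _.
      pose proof (proj1 Ba bt Bbt). repeat split; auto; order. }
    apply choice in Hbt. destruct Hbt as [bt Hbt].
    assert (Hga : forall b, exists c, b << a -> A c /\ b << c /\ c << a).
    { intro b. destruct (classic (b << a)) as [ba|]; [|now exists b].
      destruct (proj2 Asup b ba) as [c [Ac bc]]. exists c. intros _.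
      pose proof (proj1 Asup c Ac). auto. }
    apply choice in Hga. destruct Hga as [gam Hgam].
    (* First thinning: a single [i] puts the part of [A] below [g] into [W i (bt g)]. *)
    destruct (bounded_on_cofinal a (fun g => g << a) (fun g => e (bt g) (bb g)) cta) as [i [il G1sup]].
    { split; [auto|]. intros b ba. destruct (alim b ba) as [c [? ?]]; eauto. }
    { intros g ga. apply e_lam. now apply Hbt. }
    (* Second thinning: a single [i'] bounds the code of [bt g] under a later point [gam (bt g)] of
       [A]. *)
    destruct (bounded_on_cofinal a _ (fun g => e (gam (bt g)) (bt g)) cta G1sup) as [i' [i'l G2sup]].
    { intros g [ga _]. apply e_lam, Hgam. now apply Hbt. }
    exists i, i', (fun g => (g << a /\ e (bt g) (bb g) << i) /\ e (gam (bt g)) (bt g) << i'), bt.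
    split; [exact il|]. split; [exact i'l|]. split; [exact G2sup|]. split.
    + intros g [[ga _] _]. destruct (Hbt g ga) as [? [? [? ?]]]; auto.
    + intros g [[ga _] ei'].
      destruct (Hbt g ga) as [_ [_ [_ bta]]]. destruct (Hgam _ bta) as [Ac [btc ca]].
      exists (gam (bt g)). split; [exact ca|]. intros g' [[g'a ei] _] cg'.
      destruct (Hbt g' g'a) as [_ [g'bt [bbt _]]]. split; [order|].
      (* This point of [A] is below [g'], hence in [W i (bt g')]. *)
      exists (gam (bt g)). split; [|auto].
      destruct (Hbb g' g'a) as [_ Hg']. exists (bb g'). repeat split; auto.
      * now apply (Hsmall _ g').
      * now apply Hg'.
Qed.

Lemma inJ_of_regular (C : K -> Prop) : club K C -> regular K lam -> inJ K (E K theta).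
Proof.
  intros Cclub reg.
  refine (inJ_of_separation _ C (fun _ b c => c = b) _ Cclub _ _).
  - now intros x.
  - intros i b _. apply is_infinite_iff in theta_inf. destruct theta_inf as [f [ft _]].
    exists theta, (fun _ => f 0). repeat split; auto. intros c c' -> ->. reflexivity.
  - intros a cta _ B Ba. destruct cta as [[A [Acof At]] _].
    pose proof (sup_is_limit _ _ Ba) as alim.
    pose proof (cofinal_in_sup_is A a alim Acof) as Asup.
    assert (Hbt : forall x, exists bt, A x -> B bt /\ x << bt).
    { intro x. destruct (classic (A x)) as [Ax|]; [|now exists x].
      destruct (proj2 Ba x (proj1 Asup x Ax)) as [bt ?]; eauto. }
    apply choice in Hbt. destruct Hbt as [bt Hbt].
    (* Regularity is applied twice: over [x'] for fixed [x], then over [x]. *)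
    destruct (regular_union_bounded lam theta A (fun x v => exists x', A x' /\
      bt x << bt x' /\ v = e (bt x') (bt x)) reg theta_lam At) as [i' [i'l Hi']].
    { intros x Ax.
      destruct (regular_union_bounded lam theta A (fun x' v =>
        bt x << bt x' /\ v = e (bt x') (bt x)) reg theta_lam At) as [m [ml Hm]].
      - intros x' Ax'. destruct (classic (bt x << bt x')) as [h|].
        + destruct (inf_cardinal_limit lam lam_card _ (e_lam _ _ h)) as [m [? ?]].
          exists m. split; [assumption|]. now intros v [_ ->].
        + exists theta. split; [exact theta_lam|]. tauto.
      - exists m. split; [exact ml|]. intros v [x' [Ax' [? ?]]]. apply (Hm x'); auto. }
    (* [W] is the same for every [i], so any index below [lam] serves. *)
    exists theta, i', A, bt. split; [exact theta_lam|]. split; [exact i'l|].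
    split; [exact Asup|]. split.
    + intros x Ax. destruct (Hbt x Ax) as [Bbt xbt]. repeat split; auto. now apply Ba.
    + intros x Ax. exists (bt x). split; [apply Ba, Hbt, Ax|].
      intros x' Ax' xx'. destruct (Hbt x' Ax') as [_ x'bt].
      assert (lt (bt x) (bt x')) by order. split; [assumption|].
      exists (bt x'). repeat split; auto. apply (Hi' x); eauto.
Qed.

End Transfer.

(** * Choice of the injections and of the guessing point *)

Theorem theoremC (K : wo) (theta lam : K) :
  inf_cardinal K theta -> inf_cardinal K lam -> lt theta lam ->
  successor_of K lam ->
  ((exists T, subset K T (E K theta) /\ stationary K T /\ inJ K T) ->
     forall S, subset K S (E K theta) -> stationary K S -> inI K S -> inJ K S) /\
  (regular K lam ->
     (exists T, subset K T (E K theta) /\ stationary K T /\ inJ K T) ->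
     inJ K (E K theta)).
Proof.
  intros [_ theta_inf] lam_card theta_lam [_ [small_segments _]].
  assert (He : forall b : K, exists eb : K -> K,
     (forall x, lt x b -> lt (eb x) lam) /\ inj_on (fun x => lt x b) eb).
  { intro b. now apply card_le_iff. }
  apply choice in He. destruct He as [e He].
  assert (e_lam : forall b x, lt x b -> lt (e b x) lam) by (intro b; apply He).
  assert (e_inj : forall b, inj_on (fun x => lt x b) (e b)) by (intro b; apply He).
  split.
  - intros [T [TE [Tstat [C [Cclub [fs [fs_small fs_guess]]]]]]] S SE _ SI.
    (* Stationarity supplies a point of [T] in [C] above [lam], at which the given functions
       guess. *)
    destruct (Tstat _ (club_above C lam Cclub)) as [astar [Ta [Castar lam_astar]]].
    exact (inJ_of_inI theta_inf lam_card theta_lam e_lam e_inj lam_astar (TE _ Ta)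
      fs_small (fs_guess _ Ta Castar) S SE SI).
  - intros reg [T [TE [Tstat [C [Cclub [fs [fs_small fs_guess]]]]]]].
    destruct (Tstat _ (club_above C lam Cclub)) as [astar [Ta [Castar lam_astar]]].
    exact (inJ_of_regular theta_inf lam_card theta_lam e_lam e_inj lam_astar (TE _ Ta)
      fs_small (fs_guess _ Ta Castar) C Cclub reg).
Qed.
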